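(* Let $\mathcal{K}$ be a finite-dimensional complex Hilbert space and let $\Phi : \mathcal{B}(\mathcal{K}) \to \mathcal{B}(\mathcal{K})$ be a unital quantum channel. If $A = (A_1, \ldots, A_n)$ is a tuple of operators in $\mathcal{B}(\mathcal{K})$ determining $\Phi$, i.e. $\Phi(X) = \sum_{i=1}^n A_i X A_i^*$ for all $X \in \mathcal{B}(\mathcal{K})$, then the algebra $\mathfrak{A}$ generated by $A_1, \ldots, A_n$ is a $*$-algebra (i.e. is closed under adjoints) which depends only on $\Phi$ (i.e. any two tuples determining $\Phi$ generate the same algebra). Further, the fixed point set $\mathcal{B}(\mathcal{K})^\Phi$ of the map $\Phi$ coincides with the commutant of $\mathfrak{A}$, \[ \mathfrak{A}' = \{ X \in \mathcal{B}(\mathcal{K}) \;:\; A_i X = X A_i \text{ for } 1 \leq i \leq n \}, \] and hence is itself a $*$-algebra containing the identity operator on $\mathcal{K}$.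
   Context: $\mathcal{B}(\mathcal{K})$ denotes the (bounded) linear operators on $\mathcal{K}$. A quantum channel is a completely positive trace preserving map on $\mathcal{B}(\mathcal{K})$ with $\mathcal{K}$ finite-dimensional; it is unital if $\Phi(I) = I$. Every completely positive map on $\mathcal{B}(\mathcal{K})$ has the form $\Phi(X) = \sum_{i=1}^n A_i X A_i^*$ for some (non-unique) finite tuple $(A_1,\dots,A_n)$, with $n$ allowed to vary. The fixed point set is $\mathcal{B}(\mathcal{K})^\Phi = \{X \in \mathcal{B}(\mathcal{K}) : \Phi(X) = X\}$. *)

(* Defs.v *)
(* Operators on a finite-dimensional complex Hilbert space.  The space is a
   vectType K equipped with a positive definite Hermitian form
   dot : {dot K for conjC}, linear in its first argument and conjugate linear
   in its second; B(K) is the type 'End(K) of its linear endomorphisms. *)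
From HB Require Import structures.
From mathcomp Require Import all_boot all_order all_algebra.
From mathcomp Require Import sesquilinear.
From mathcomp Require Import boolp classical_sets.

Set Implicit Arguments.
Unset Strict Implicit.
Unset Printing Implicit Defensive.

Import Order.TTheory GRing.Theory Num.Theory Num.Def.

Local Open Scope classical_set_scope.
Local Open Scope ring_scope.

Section HilbertOperators.
Variables (C : numClosedFieldType) (K : vectType C) (dot : {dot K for conjC}).
Implicit Types (X Y : 'End(K)) (S : set 'End(K)).

Definition is_adjoint X Y := forall u v : K, dot (X u) v = dot u (Y v).

(* The default value 0 is never used, see adjointP. *)
Definition adjoint X : 'End(K) := xget 0 [set Y | is_adjoint X Y].

Lemma exists_adjoint X : exists Y, is_adjoint X Y.
Proof.
pose b := vbasis {: K}.
have bE (w : K) : w = \sum_i coord b i w *: b`_i.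
  exact: coord_vbasis (memvf w).
pose j (w : K) : 'rV[C]_(\dim {: K}) := \row_i dot w b`_i.
have jlin : linear j.
  by move=> a u v; apply/rowP=> i; rewrite !mxE linearPl.
pose J0 : {linear K -> 'rV[C]_(\dim {: K})} :=
  HB.pack j (GRing.isLinear.Build _ _ _ _ j jlin).
pose J := linfun J0.
have Jker : lker J == 0%VS.
  apply/lker0P => u v; rewrite !lfunE /= => /rowP juv.
  apply/eqP; rewrite -subr_eq0 -(dnorm_eq0 dot); apply/eqP.
  rewrite {2}(bE (u - v)) linear_sumr big1 // => i _.
  rewrite linearZ /= linearBl.
  have := juv i; rewrite !mxE => juvi; apply/eqP.
  by rewrite mulf_eq0 subr_eq0; apply/orP; right; apply/eqP.
have Jfull (r : 'rV[C]_(\dim {: K})) : J (J^-1%VF r) = r.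
  apply: limg_lfunVK.
  suff -> : limg J = fullv by exact: memvf.
  apply/eqP; rewrite eqEdim subvf /= limg_dim_eq; last first.
    by rewrite (eqP Jker) capv0.
  by rewrite [X in (X <= _)%N]dimvf /dim /= mul1n.
pose g (v : K) : K := J^-1%VF (\row_i dot v (X b`_i)).
have glin : linear g.
  move=> a u v; rewrite /g -linearP; congr (J^-1%VF _).
  by apply/rowP=> i; rewrite !mxE linearPl.
pose G : {linear K -> K} := HB.pack g (GRing.isLinear.Build _ _ _ _ g glin).
exists (linfun G) => u v; rewrite lfunE /=.
rewrite (hermC dot (X u)) (hermC dot u) /= !expr0 !mul1r; congr (_^*).
rewrite {1}(bE u) {2}(bE u) linear_sum !linear_sumr; apply: eq_bigr => i _.
rewrite !linearZ /=; congr (_ * _).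
have := Jfull (\row_i dot v (X b`_i)).
by rewrite lfunE /= => /rowP/(_ i); rewrite !mxE => ->.
Qed.

Lemma adjointP X : is_adjoint X (adjoint X).
Proof. by have [Y XY] := exists_adjoint X; apply: (xgetPex 0); exists Y. Qed.

(* The value does not depend on the basis. *)
Definition optrace X : C := \tr (passmx.mxof (vbasis {: K}) (vbasis {: K}) X).

(* A k x k matrix of operators, seen as an operator on K ^ k, is positive. *)
Definition block_positive k (T : 'M['End(K)]_k) : Prop :=
  forall v : 'I_k -> K, 0 <= \sum_i \sum_j dot (T i j (v j)) (v i).

Definition completely_positive (Phi : 'End(K) -> 'End(K)) : Prop :=
  forall k (T : 'M['End(K)]_k),
    block_positive T -> block_positive (map_mx Phi T).

Definition trace_preserving (Phi : 'End(K) -> 'End(K)) : Prop :=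
  forall X, optrace (Phi X) = optrace X.

Definition quantum_channel (Phi : {linear 'End(K) -> 'End(K)}) : Prop :=
  completely_positive Phi /\ trace_preserving Phi.

Definition unital (Phi : 'End(K) -> 'End(K)) : Prop := Phi \1%VF = \1%VF.

Definition determines n (A : 'I_n -> 'End(K)) (Phi : 'End(K) -> 'End(K)) :=
  forall X, Phi X = \sum_i (A i \o X \o adjoint (A i))%VF.

(* Subalgebras are not required to contain the identity. *)
Definition subalgebra S : Prop :=
  [/\ S 0,
      forall (a : C) X Y, S X -> S Y -> S (a *: X + Y) &
      forall X Y, S X -> S Y -> S (X \o Y)%VF].

Definition star_closed S : Prop := forall X, S X -> S (adjoint X).

Definition star_algebra S : Prop := subalgebra S /\ star_closed S.

Definition generated_algebra n (A : 'I_n -> 'End(K)) : set 'End(K) :=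
  smallest subalgebra (range A).

Definition commutant S : set 'End(K) :=
  [set X | forall Y, S Y -> (Y \o X)%VF = (X \o Y)%VF].

Definition fixed_points (Phi : 'End(K) -> 'End(K)) : set 'End(K) :=
  [set X | Phi X = X].

End HilbertOperators.

(* Main.v *)
(* Unitality and trace preservation mean sum_i A_i A_i* = 1 = sum_i A_i* A_i.
   Everything takes place in B(K) with the Hilbert-Schmidt inner product.

   For X = Phi X and D_i = A_i X - X A_i, the trace of sum_i D_i D_i* is
   tr (Phi Z - Z) = 0 with Z = X X*, so all D_i vanish: fixed points commute
   with the A_i.

   Left multiplications by the A_i satisfy the same two identities as the A_i,
   and counting dimensions in Bessel's inequality shows that every subspace
   invariant under them is invariant under their adjoints.  The generated
   algebra, being such a subspace, contains A_i* A_j for all i and j, hence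
   1 = sum_i A_i* A_i, hence A_i* = A_i* 1.

   For any Z, sum_i |<A_i, Z>|^2 is a function of Phi alone, so two tuples
   determining Phi have the same orthogonal complement, thus the same span. *)
Require Import Defs.
From HB Require Import structures.
From mathcomp Require Import all_boot all_order all_algebra.
From mathcomp Require Import sesquilinear.
From mathcomp Require Import boolp classical_sets reals.
From mathcomp Require Import complex.

Set Implicit Arguments.
Unset Strict Implicit.
Unset Printing Implicit Defensive.

Import Order.TTheory GRing.Theory Num.Theory Num.Def.

Local Open Scope classical_set_scope.
Local Open Scope ring_scope.

(** * Orthonormal families and Bessel's inequality *)

Section OrthonormalFamilies.
Variables (C : numClosedFieldType) (V : vectType C) (dot : {dot V for conjC}).
Implicit Types (u v w : V) (s : seq V) (M : {vspace V}).

Lemma dotC u v : dot u v = (dot v u)^*.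
Proof. by rewrite hermC /= expr0 mul1r. Qed.

Lemma dotZl a u v : dot (a *: u) v = a * dot u v.
Proof. exact: linearZl_LR. Qed.

Lemma dotZr a u v : dot u (a *: v) = a^* * dot u v.
Proof. exact: linearZr_LR. Qed.

Lemma eq_dotr u v : (forall w, dot w u = dot w v) -> u = v.
Proof.
move=> uv; apply/eqP; rewrite -subr_eq0 -(dnorm_eq0 dot) linearBr /=.
by rewrite uv subrr.
Qed.

(** Gram-Schmidt along a spanning sequence: [y], the part of [x] orthogonal to the family built so
    far, is dropped when zero and normalised otherwise. *)
Lemma exists_orthonormal_basis M :
  exists2 s, orthonormal dot s & <<s>>%VS = M.
Proof.
suff basis_span (t : seq V) :
    exists2 s, orthonormal dot s & <<s>>%VS = <<t>>%VS.
  have [s os sM] := basis_span (vbasis M).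
  by exists s => //; rewrite sM (span_basis (vbasisP M)).
elim: t => [|x t [s os st]]; first by exists [::].
have [p ps [y [-> _ ys]]] := orthogonal_split dot s x.
have [->|y_neq0] := eqVneq y 0.
  exists s => //; rewrite span_cons addr0 -st; apply/esym/addv_idPr.
  by rewrite -memvE.
pose e := (sqrtC (dot y y))^-1 *: y.
have e1 : dot e e = 1.
  rewrite dotZl dotZr geC0_conj ?invr_ge0 ?sqrtC_ge0 //.
  by rewrite mulrA -invfM -expr2 sqrtCK mulVf // dnorm_eq0.
exists (e :: s).
  rewrite -cat1s orthonormal_cat os andTb; apply/andP; split.
    by rewrite /orthonormal /= !andbT; apply/eqP.
  apply/orthoPl => v vs.
  by rewrite [LHS]dotZl (orthoPl ys _ vs) mulr0.
have line_e : <[e]>%VS = <[y]>%VS.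
  apply/eqP; rewrite eqEdim !dim_vline scaler_eq0 invr_eq0 sqrtC_eq0 dnorm_eq0.
  rewrite (negPf y_neq0) leqnn andbT.
  by rewrite -memvE memvZ ?memv_line.
apply/eqP; rewrite !span_cons -st line_e eqEsubv !subv_add !addvSr.
rewrite -!memvE !andbT.
apply/andP; split.
  by rewrite -{1}[y](addKr p) addrC memv_add ?memv_line ?memvN.
by rewrite [p + y]addrC memv_add ?memv_line.
Qed.

Lemma residual_orthogonal s v w : orthonormal dot s -> w \in <<s>>%VS ->
  dot (v - \sum_(e <- s) dot v e *: e) w = 0.
Proof.
move=> /orthonormalP[us os] ws.
apply: span_orthogonal (memv_span1 _) ws.
apply/orthoPl => f fs; rewrite linearBl linear_sumlz /=.
rewrite (bigD1_seq f) //= big1_seq ?addr0; last first.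
  by move=> e /andP[ef es]; rewrite dotZl (os e f) // (negPf ef) mulr0.
by rewrite dotZl (os f f) // eqxx mulr1 subrr.
Qed.

Lemma orthonormal_expansion s v :
  orthonormal dot s -> v \in <<s>>%VS -> v = \sum_(e <- s) dot v e *: e.
Proof.
move=> os vs; apply/eqP; rewrite -subr_eq0 -(dnorm_eq0 dot).
rewrite residual_orthogonal // memvB // big_seq memv_suml // => e es.
by rewrite memvZ // memv_span.
Qed.

Lemma parseval s v w : orthonormal dot s -> v \in <<s>>%VS ->
  dot v w = \sum_(e <- s) dot v e * dot e w.
Proof.
move=> os vs; rewrite [in LHS](orthonormal_expansion os vs) linear_sumlz /=.
by apply: eq_bigr => e _; rewrite dotZl.
Qed.

(** Pythagoras: the residual [r] is orthogonal to the projection of [v], so <r, r> = <r, v>. *)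
Lemma bessel_defect s v : orthonormal dot s ->
  let r := v - \sum_(e <- s) dot v e *: e in
  dot r r = dot v v - \sum_(e <- s) dot v e * dot e v.
Proof.
move=> os r; rewrite {2}/r linearBr /= [X in _ - X]residual_orthogonal ?subr0 //;
  last first.
  by rewrite big_seq memv_suml // => e es; rewrite memvZ // memv_span.
rewrite linearBl linear_sumlz /=; congr (_ - _).
by apply: eq_bigr => e _; rewrite dotZl.
Qed.

(* Both sides of Bessel's inequality for the vectors [b i f], summed over [i]
   and over an orthonormal basis [f] of [M], equal the dimension of [M]: the
   sum of the [|dot (b i f) e|^2] is also that of the [|dot (a i e) f|^2], to
   which Parseval applies because [a i e] lies in [M]. *)
Lemma invariant_subspace_adjoint n (a b : 'I_n -> {linear V -> V}) M :
    (forall i u v, dot (a i u) v = dot u (b i v)) ->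
    (forall u, \sum_i dot (a i u) (a i u) = dot u u) ->
    (forall u, \sum_i dot (b i u) (b i u) = dot u u) ->
    (forall i u, u \in M -> a i u \in M) ->
  forall i u, u \in M -> b i u \in M.
Proof.
move=> ab aa bb aM; have [s os sM] := exists_orthonormal_basis M.
pose r i f := b i f - \sum_(e <- s) dot (b i f) e *: e.
have rE i f : dot (r i f) (r i f) =
    dot (b i f) (b i f) - \sum_(e <- s) dot (b i f) e * dot e (b i f).
  exact: bessel_defect.
have rs f : \sum_i dot (r i f) (r i f) =
    dot f f - \sum_i \sum_(e <- s) dot (b i f) e * dot e (b i f).
  by rewrite -bb -sumrB; apply: eq_bigr => i _; exact: rE.
have r0 : \sum_(f <- s) \sum_i dot (r i f) (r i f) = 0.
  rewrite (eq_bigr _ (fun f _ => rs f)) sumrB.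
  apply/eqP; rewrite subr_eq0; apply/eqP.
  under [RHS]eq_bigr do rewrite exchange_big.
  rewrite [RHS]exchange_big [LHS]big_seq [RHS]big_seq; apply: eq_bigr => e es.
  rewrite [RHS]exchange_big -[LHS]aa; apply: eq_bigr => i _ /=.
  have aes : a i e \in <<s>>%VS by rewrite sM aM // -sM memv_span.
  rewrite (parseval _ os aes); apply: eq_bigr => f _.
  by rewrite -!ab mulrC [dot f _]dotC ab -dotC.
(* A zero sum of nonnegative terms vanishes termwise, and a zero residual makes [b i f] equal to its
   projection on [M]. *)
have bs i f : f \in s -> b i f \in M.
  move=> fs; have : dot (r i f) (r i f) = 0.
    have r_ge0 j g : 0 <= dot (r j g) (r j g) by [].
    move/eqP: r0; rewrite psumr_eq0 => [/allP/(_ f fs)/=|g _]; last first.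
      exact: sumr_ge0.
    by rewrite psumr_eq0 // => /allP/(_ i (mem_index_enum _))/= /eqP.
  move/eqP; rewrite dnorm_eq0 subr_eq0 => /eqP ->.
  by rewrite -sM big_seq memv_suml // => e es; rewrite memvZ // memv_span.
move=> i u; rewrite -sM => us; rewrite (orthonormal_expansion os us) linear_sum.
rewrite sM big_seq memv_suml // => f fs; rewrite linearZ memvZ //.
exact: bs.
Qed.

End OrthonormalFamilies.

(** * From linear sets to subspaces, and sums of compositions *)

(** Take for [M] a subspace inside [S] of maximal dimension: for [v] in [S] the sum [M + <[v]>]
    still lies in [S], so it equals [M]. *)
Lemma linear_closed_vspace (F : fieldType) (V : vectType F) (S : set V) :
    S 0 -> (forall a u v, S u -> S v -> S (a *: u + v)) ->
  exists M : {vspace V}, forall v, (v \in M) = `[< S v >].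
Proof.
move=> S0 Slin.
pose P (d : nat) :=
  `[< exists2 M : {vspace V}, {in M, forall v, S v} & \dim M = d >].
have exP : exists d, P d.
  exists 0%N; apply/asboolP; exists 0%VS; last exact: dimv0.
  by move=> v; rewrite memv0 => /eqP ->.
have leP d : P d -> (d <= \dim {: V})%N.
  by move=> /asboolP[M _ <-]; exact: dimvS (subvf M).
have [d /asboolP[M MS <-] maxd] := ex_maxnP exP leP.
exists M => v; apply/idP/asboolP => [/MS //|Sv].
suff /eqP -> : M == (M + <[v]>)%VS by rewrite (subvP (addvSr _ _)) ?memv_line.
rewrite eqEdim addvSl maxd //; apply/asboolP; exists (M + <[v]>)%VS => //.
move=> _ /memv_addP[u uM [_ /vlineP[a ->] ->]]; rewrite addrC.
by apply: Slin => //; apply: MS.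
Qed.

Lemma comp_lfun_suml (F : fieldType) (U V W : vectType F) (I : finType)
    (f : I -> 'Hom(V, W)) (g : 'Hom(U, V)) :
  ((\sum_i f i) \o g = \sum_i (f i \o g))%VF.
Proof.
exact: (big_morph (fun h => h \o g)%VF
  (fun f1 f2 => comp_lfunDl f1 f2 g) (comp_lfun0l _ g)).
Qed.

Lemma comp_lfun_sumr (F : fieldType) (U V W : vectType F) (I : finType)
    (f : 'Hom(V, W)) (g : I -> 'Hom(U, V)) :
  (f \o (\sum_i g i) = \sum_i (f \o g i))%VF.
Proof.
exact: (big_morph (fun h => f \o h)%VF (comp_lfunDr f) (comp_lfun0r _ f)).
Qed.

(** * Adjoints, the trace and the Hilbert-Schmidt inner product *)

Section HilbertSchmidt.
Variables (C : numClosedFieldType) (K : vectType C) (dot : {dot K for conjC}).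
Implicit Types X Y Z : 'End(K).

(** Nondegeneracy of [dot] makes adjoints unique; the algebraic rules for [adjoint] reduce to
    this. *)
Lemma adjoint_eq X Y : is_adjoint dot X Y -> adjoint dot X = Y.
Proof.
move=> XY; apply/lfunP => v; apply: (eq_dotr (dot := dot)) => u.
by rewrite -XY -adjointP.
Qed.

Lemma adjointK X : adjoint dot (adjoint dot X) = X.
Proof. by apply: adjoint_eq => u v; rewrite dotC -adjointP -dotC. Qed.

Lemma adjoint_comp X Y :
  adjoint dot (X \o Y)%VF = (adjoint dot Y \o adjoint dot X)%VF.
Proof. by apply: adjoint_eq => u v; rewrite !comp_lfunE !adjointP. Qed.

Lemma adjoint_conj_linear a X Y :
  adjoint dot (a *: X + Y) = a^* *: adjoint dot X + adjoint dot Y.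
Proof.
apply: adjoint_eq => u v; rewrite !lfun_simp linearDl linearDr /=.
by rewrite dotZl dotZr conjCK !adjointP.
Qed.

Lemma adjoint0 : adjoint dot 0 = 0.
Proof. by apply: adjoint_eq => u v; rewrite !zero_lfunE linear0l linear0r. Qed.

Lemma adjointD X Y : adjoint dot (X + Y) = adjoint dot X + adjoint dot Y.
Proof. by have := adjoint_conj_linear 1 X Y; rewrite rmorph1 !scale1r. Qed.

Lemma adjointB X Y : adjoint dot (X - Y) = adjoint dot X - adjoint dot Y.
Proof.
have := adjoint_conj_linear (-1) Y X.
by rewrite rmorphN rmorph1 !scaleN1r ![- _ + _]addrC.
Qed.

Lemma adjoint_sum I (r : seq I) (P : pred I) (F : I -> 'End(K)) :
  adjoint dot (\sum_(i <- r | P i) F i) =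
  \sum_(i <- r | P i) adjoint dot (F i).
Proof. exact: (big_morph _ adjointD adjoint0). Qed.

Lemma optrace_linear a X Y : optrace (a *: X + Y) = a * optrace X + optrace Y.
Proof. by rewrite /optrace passmx.mxof_linear linearP. Qed.

Lemma optraceC X Y : optrace (X \o Y)%VF = optrace (Y \o X)%VF.
Proof.
by rewrite /optrace !(passmx.mxof_comp _ _ (vbasisP fullv)) mxtrace_mulC.
Qed.

Lemma optrace_sum I (r : seq I) (P : pred I) (F : I -> 'End(K)) :
  optrace (\sum_(i <- r | P i) F i) = \sum_(i <- r | P i) optrace (F i).
Proof.
have trD X Y : optrace (X + Y) = optrace X + optrace Y.
  by have := optrace_linear 1 X Y; rewrite !scale1r mul1r.
apply: (big_morph _ trD).
by have := optrace_linear (-1) 0 0; rewrite scaler0 addr0 mulN1r addNr.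
Qed.

Lemma optrace_orthonormal (s : seq K) X :
    orthonormal dot s -> <<s>>%VS = fullv ->
  optrace X = \sum_(e <- s) dot (X e) e.
Proof.
move=> os s_full; pose b := vbasis {: K}.
have mem_s v : v \in <<s>>%VS by rewrite s_full memvf.
rewrite /optrace /mxtrace.
transitivity (\sum_(i < \dim {: K}) \sum_(e <- s) dot b`_i e * coord b i (X e)).
  apply: eq_bigr => i _; rewrite !mxE /= passmx.vecof_delta.
  rewrite {1}(orthonormal_expansion os (mem_s b`_i)) !linear_sum.
  by apply: eq_bigr => e _; rewrite !linearZ.
rewrite exchange_big; apply: eq_bigr => e _ /=.
rewrite {2}(coord_vbasis (memvf (X e))) linear_sumlz.
by apply: eq_bigr => i _; rewrite [RHS]dotZl mulrC.
Qed.

(** The adjoint sits on the second argument so that, as for [dot], linearity is in the first. *)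
Definition hs X Y : C := optrace (adjoint dot Y \o X)%VF.

Lemma hs_orthonormal (s : seq K) X Y :
    orthonormal dot s -> <<s>>%VS = fullv ->
  hs X Y = \sum_(e <- s) dot (X e) (Y e).
Proof.
move=> os s_full; rewrite /hs (optrace_orthonormal _ os s_full).
by apply: eq_bigr => e _; rewrite comp_lfunE [LHS]dotC -adjointP -dotC.
Qed.

Lemma hs_comp_adjoint A X Y :
  hs (A \o X)%VF Y = hs X (adjoint dot A \o Y)%VF.
Proof. by rewrite /hs adjoint_comp adjointK comp_lfunA. Qed.

Let hs_bilinear : bilinear_for
  (GRing.Scale.Law.clone _ _ ( *%R ) _)
  (GRing.Scale.Law.clone _ _ (conjC \; *%R) _) hs.
Proof.
split=> [Y a X X'|X a Y Y']; rewrite /hs.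
  by rewrite comp_lfunDr -comp_lfunZr optrace_linear.
by rewrite adjoint_conj_linear comp_lfunDl -comp_lfunZl optrace_linear.
Qed.

Let hs_hermitian X Y : hs X Y = (-1) ^+ false * (hs Y X)^*.
Proof.
have [s os s_full] := exists_orthonormal_basis dot fullv.
rewrite expr0 mul1r !(hs_orthonormal _ _ os s_full) rmorph_sum.
by apply: eq_bigr => e _; exact: dotC.
Qed.

Let hs_positive X : X != 0 -> 0 < hs X X.
Proof.
have [s os s_full] := exists_orthonormal_basis dot fullv.
rewrite (hs_orthonormal _ _ os s_full) => X_neq0.
rewrite lt_def sumr_ge0 // andbT; apply: contra X_neq0.
rewrite psumr_eq0 // => /allP Xs; apply/eqP/lfunP => v.
rewrite (orthonormal_expansion (v := v) os) ?s_full ?memvf // linear_sum.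
rewrite zero_lfunE big_seq big1 // => e /Xs /=.
by rewrite dnorm_eq0 => /eqP Xe0; rewrite linearZ /= Xe0 scaler0.
Qed.

(** Through these instances the results on orthonormal families apply to operators. *)
HB.instance Definition _ :=
  bilinear_isBilinear.Build _ _ _ _ _ _ hs hs_bilinear.
HB.instance Definition _ :=
  isHermitianSesquilinear.Build _ _ _ _ hs hs_hermitian.
HB.instance Definition _ := isDotProduct.Build _ _ hs hs_positive.

End HilbertSchmidt.

(** * Tuples determining one map have the same span *)

Section KrausOperators.
Variables (C : numClosedFieldType) (K : vectType C) (dot : {dot K for conjC}).
Implicit Types X Y Z : 'End(K).
Local Notation hs := (hs dot).
Local Notation adj := (adjoint dot).

(** The operator often written |e><f|. [linfun] takes a bare function here; its linearity is proved
    where its values are needed. *)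
Let rank_one (e f : K) : 'End(K) :=
  linfun (fun w => dot w f *: e).

(** The right-hand side sees the tuple only through [Phi]. At [Z f], the operator A_i |e><f|
    adj(A_i) gives [A i e] times <Z f, A_i f>, the conjugate of <A_i f, Z f>. *)
Lemma kraus_hs n (A : 'I_n -> 'End(K)) Phi (s : seq K) Z :
    orthonormal dot s -> <<s>>%VS = fullv -> determines dot A Phi ->
  \sum_i hs (A i) Z * (hs (A i) Z)^* =
  \sum_(e <- s) \sum_(f <- s) dot (Phi (rank_one e f) (Z f)) (Z e).
Proof.
move=> os s_full APhi.
transitivity (\sum_i \sum_(e <- s) \sum_(f <- s)
    dot (A i e) (Z e) * (dot (A i f) (Z f))^*).
  apply: eq_bigr => i _; rewrite (hs_orthonormal _ _ os s_full) rmorph_sum.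
  by rewrite mulr_suml; apply: eq_bigr => e _; rewrite mulr_sumr.
rewrite exchange_big; apply: eq_bigr => e _.
rewrite exchange_big; apply: eq_bigr => f _ /=.
rewrite APhi sum_lfunE linear_sumlz; apply: eq_bigr => i _ /=.
have rank_oneE w : rank_one e f w = dot w f *: e.
  have lin : linear (fun w => dot w f *: e).
    by move=> a u v; rewrite linearDl /= dotZl scalerDl scalerA.
  pose T : {linear K -> K} := HB.pack (fun w => dot w f *: e)
    (GRing.isLinear.Build _ _ _ _ _ lin).
  exact: (lfunE T).
rewrite !comp_lfunE rank_oneE linearZ [RHS]dotZl mulrC; congr (_ * _).
by rewrite -dotC [RHS]adjointP adjointK.
Qed.

(** For the component [Y] of [B j] orthogonal to all [A i], the sum of the |<B_i, Y>|^2 equals that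
    of the |<A_i, Y>|^2, which is 0; so <Y, Y> = <B_j, Y> = 0. *)
Lemma kraus_span n m (A : 'I_n -> 'End(K)) (B : 'I_m -> 'End(K)) Phi :
    determines dot A Phi -> determines dot B Phi ->
  forall j, B j \in <<codom A>>%VS.
Proof.
move=> APhi BPhi j; have [s os s_full] := exists_orthonormal_basis dot fullv.
have [X XA [Y [BXY XY AY]]] := orthogonal_split hs (codom A) (B j).
have hsBY : \sum_i hs (B i) Y * (hs (B i) Y)^* = 0.
  rewrite (kraus_hs _ os s_full BPhi) -(kraus_hs _ os s_full APhi).
  apply: big1 => i _; rewrite [hs _ _]dotC.
  by rewrite (orthoPl AY) ?codom_f// conjC0 mul0r.
have : hs (B j) Y * (hs (B j) Y)^* = 0.
  by apply: (psumr_eq0P _ hsBY) => // i _; exact: mul_conjC_ge0.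
move=> /eqP; rewrite mul_conjC_eq0 BXY linearDl /= XY add0r.
by rewrite dnorm_eq0 => /eqP ->; rewrite addr0.
Qed.

(** * Generated algebras and their commutants *)

Lemma generated_algebra_subalgebra n (A : 'I_n -> 'End(K)) :
  subalgebra (generated_algebra A).
Proof.
split=> [S [[S0 _ _] _]|a X Y SX SY S SA|X Y SX SY S SA] //.
  have [[_ Slin _] _] := SA.
  by apply: Slin; [apply: SX|apply: SY].
have [[_ _ Scomp] _] := SA.
by apply: Scomp; [apply: SX|apply: SY].
Qed.

Lemma generated_algebra_gen n (A : 'I_n -> 'End(K)) i :
  generated_algebra A (A i).
Proof. by move=> S [_]; apply; exists i. Qed.

Lemma generated_algebra_sub n (A : 'I_n -> 'End(K)) (S : set 'End(K)) :
  subalgebra S -> (forall i, S (A i)) -> generated_algebra A `<=` S.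
Proof. by move=> algS SA; apply: smallest_sub => // _ [i _ <-]. Qed.

Lemma subalgebra_vspace (S : set 'End(K)) : subalgebra S ->
  exists M : {vspace 'End(K)}, forall X, (X \in M) = `[< S X >].
Proof. by case=> S0 Slin _; exact: linear_closed_vspace. Qed.

Lemma kraus_generated_algebra_sub n m
    (A : 'I_n -> 'End(K)) (B : 'I_m -> 'End(K)) Phi :
    determines dot A Phi -> determines dot B Phi ->
  generated_algebra B `<=` generated_algebra A.
Proof.
move=> APhi BPhi; have algA := generated_algebra_subalgebra A.
apply: generated_algebra_sub => // j; have [M MA] := subalgebra_vspace algA.
apply/asboolP; rewrite -MA; apply: subvP (kraus_span APhi BPhi j).
apply/span_subvP => _ /codomP[i ->]; rewrite MA; apply/asboolP.
exact: generated_algebra_gen.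
Qed.

(** The operators commuting with a given [X] form a subalgebra, so testing on generators
    suffices. *)
Lemma commutant_generated_algebra n (A : 'I_n -> 'End(K)) :
  commutant (generated_algebra A) =
  [set X | forall i, (A i \o X)%VF = (X \o A i)%VF].
Proof.
apply/seteqP; split=> X /= AX.
  by move=> i; apply: AX; exact: generated_algebra_gen.
move=> Y.
apply: (generated_algebra_sub (S := [set Y | Y \o X = X \o Y]%VF)) => //.
split=> /= [|a Y1 Y2 XY1 XY2|Y1 Y2 XY1 XY2].
- by rewrite comp_lfun0l comp_lfun0r.
- by rewrite comp_lfunDl comp_lfunDr -comp_lfunZl -comp_lfunZr XY1 XY2.
- by rewrite -comp_lfunA XY2 comp_lfunA XY1 comp_lfunA.
Qed.

(** * Star closure and fixed points under the two Kraus identities *)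

Section UnitalTracePreserving.
Variables (n : nat) (A : 'I_n -> 'End(K)).
Hypothesis sum_AAadj : \sum_i (A i \o adj (A i))%VF = \1%VF.
Hypothesis sum_adjAA : \sum_i (adj (A i) \o A i)%VF = \1%VF.

Let lcomp X : {linear 'End(K) -> 'End(K)} :=
  HB.pack (comp_lfun X) (GRing.isLinear.Build _ _ _ _ (comp_lfun X)
    (fun a Y Z => etrans (comp_lfunDr X (a *: Y) Z)
       (congr1 (+%R^~ (X \o Z)%VF) (esym (comp_lfunZr a X Y))))).

(** Supplies the norm hypotheses of [invariant_subspace_adjoint]: moving [B i] across [hs] gives the
    sum of the <X, adj(B_i) B_i X>. *)
Lemma hs_comp_sum X (B : 'I_n -> 'End(K)) :
    \sum_i (adj (B i) \o B i)%VF = \1%VF ->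
  \sum_i hs (lcomp (B i) X) (lcomp (B i) X) = hs X X.
Proof.
move=> sumB; rewrite -{4}[X]comp_lfun1l -sumB comp_lfun_suml linear_sumr.
apply: eq_bigr => i _ /=.
by rewrite hs_comp_adjoint comp_lfunA.
Qed.

Lemma generated_algebra_star : star_algebra dot (generated_algebra A).
Proof.
have algA := generated_algebra_subalgebra A; have [S0 Slin Scomp] := algA.
have genA i : generated_algebra A (A i) by exact: generated_algebra_gen.
split=> //; have [M MA] := subalgebra_vspace algA.
have lA i X : X \in M -> lcomp (A i) X \in M.
  rewrite !MA => /asboolP SX; apply/asboolP.
  by apply: Scomp; first exact: genA.
have sum_adjadj : \sum_i (adj (adj (A i)) \o adj (A i))%VF = \1%VF.
  by rewrite -[RHS]sum_AAadj; apply: eq_bigr => i _; rewrite adjointK.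
have ladjA i X : X \in M -> lcomp (adj (A i)) X \in M.
  apply: (invariant_subspace_adjoint (dot := hs) (a := fun i => lcomp (A i))
    (b := fun i => lcomp (adj (A i)))) => // [j Y Z|Y|Y].
  - exact: hs_comp_adjoint.
  - exact: hs_comp_sum.
  - exact: hs_comp_sum.
(* A subalgebra need not contain the identity; here it is a sum of products adj(A_i) A_i, each now
   known to lie in [M]. *)
have M1 : \1%VF \in M.
  rewrite -sum_adjAA memv_suml // => i _; apply: ladjA.
  by rewrite MA; apply/asboolP; exact: genA.
have adjA i : generated_algebra A (adj (A i)).
  by apply/asboolP; rewrite -MA -[adj _]comp_lfun1r; exact: ladjA.
(* The operators whose adjoint lies in the generated algebra form a subalgebra containing every
   [A i]. *)
apply: (generated_algebra_sub
  (S := [set X | generated_algebra A (adj X)])) => //.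
split=> /= [|a X Y SX SY|X Y SX SY].
- by rewrite adjoint0.
- by rewrite adjoint_conj_linear; apply: Slin.
- by rewrite adjoint_comp; apply: Scomp.
Qed.

Lemma fixed_point_commutes X : \sum_i (A i \o X \o adj (A i))%VF = X ->
  forall i, (A i \o X)%VF = (X \o A i)%VF.
Proof.
move=> fixX; pose D i : 'End(K) := ((A i \o X) - (X \o A i))%VF.
have fix_adj : \sum_i (A i \o adj X \o adj (A i))%VF = adj X.
  rewrite -[in RHS]fixX adjoint_sum; apply: eq_bigr => i _.
  by rewrite !adjoint_comp adjointK comp_lfunA.
(* Write X' for the adjoint of [X] and F(Z) for the sum of the A_i Z adj(A_i). Expansion gives F(X
   X') - F(X) X' - X F(X') + X X', where F fixes both [X] and X'. *)
have DD : \sum_i (D i \o adj (D i))%VF =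
    \sum_i (A i \o (X \o adj X) \o adj (A i))%VF - (X \o adj X)%VF.
  transitivity (\sum_i (A i \o (X \o adj X) \o adj (A i))%VF
      - ((\sum_i (A i \o X \o adj (A i))) \o adj X)%VF
      - (X \o (\sum_i (A i \o adj X \o adj (A i))))%VF
      + (X \o (\sum_i (A i \o adj (A i))) \o adj X)%VF).
    rewrite !comp_lfun_sumr !comp_lfun_suml -!sumrB -big_split /=.
    apply: eq_bigr => i _; rewrite /D adjointB !adjoint_comp.
    rewrite comp_lfunDl !comp_lfunDr !comp_lfunNl !comp_lfunNr opprK.
    by rewrite !comp_lfunA !addrA.
  by rewrite fixX fix_adj sum_AAadj comp_lfun1r subrK.
(* Each term is the trace of D_i adj(D_i). Cyclicity and [sum_adjAA] show that F preserves the
   trace. *)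
have trDD : \sum_i hs (adj (D i)) (adj (D i)) = 0.
  have trB Y Z : optrace (Y - Z) = optrace Y - optrace Z.
    by rewrite addrC -scaleN1r optrace_linear mulN1r addrC.
  have hsD i : hs (adj (D i)) (adj (D i)) = optrace (D i \o adj (D i))%VF.
    by rewrite -{3}(@adjointK _ _ dot (D i)).
  rewrite (eq_bigr _ (fun i _ => hsD i)) -optrace_sum DD trB optrace_sum.
  under eq_bigr do rewrite -comp_lfunA optraceC -comp_lfunA.
  by rewrite -optrace_sum -comp_lfun_sumr sum_adjAA comp_lfun1r subrr.
move=> i; apply/eqP; rewrite -subr_eq0; apply/eqP.
rewrite -[LHS](@adjointK _ _ dot).
have : hs (adj (D i)) (adj (D i)) = 0.
  by apply: (psumr_eq0P _ trDD) => // j _; exact: (dnorm_ge0 hs).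
by move=> /eqP; rewrite dnorm_eq0 => /eqP; rewrite /D => ->; rewrite adjoint0.
Qed.

(** Conversely, if [X] commutes with the [A i], it factors out of the sum to the left, leaving the
    sum of the A_i adj(A_i), which is 1. *)
Lemma fixed_points_commutant Phi : determines dot A Phi ->
  fixed_points Phi = commutant (generated_algebra A).
Proof.
move=> APhi; rewrite commutant_generated_algebra; apply/seteqP; split=> X /=.
  by rewrite /fixed_points /= APhi => /fixed_point_commutes.
move=> AX; rewrite /fixed_points /= APhi.
under eq_bigr do rewrite AX -comp_lfunA.
by rewrite -comp_lfun_sumr sum_AAadj comp_lfun1r.
Qed.

End UnitalTracePreserving.

(** * The Kraus identities of a unital channel, and the algebra of fixed points *)

Lemma unital_kraus n (A : 'I_n -> 'End(K)) Phi :
    unital Phi -> determines dot A Phi ->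
  \sum_i (A i \o adj (A i))%VF = \1%VF.
Proof.
move=> uPhi APhi; rewrite -[RHS]uPhi APhi.
by apply: eq_bigr => i _; rewrite comp_lfun1r.
Qed.

(** By cyclicity tr(S X) = tr X for all [X]; taking X = adj(S - 1) gives <S - 1, S - 1> = 0. *)
Lemma trace_preserving_kraus n (A : 'I_n -> 'End(K)) Phi :
    trace_preserving Phi -> determines dot A Phi ->
  \sum_i (adj (A i) \o A i)%VF = \1%VF.
Proof.
move=> tPhi APhi; set S := \sum_i _.
have trS X : optrace (S \o X)%VF = optrace X.
  rewrite -[RHS]tPhi APhi comp_lfun_suml !optrace_sum; apply: eq_bigr => i _.
  by rewrite [RHS]optraceC comp_lfunA.
apply/eqP; rewrite -subr_eq0 -(dnorm_eq0 hs) /=; apply/eqP.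
rewrite /hs /= optraceC comp_lfunDl comp_lfunNl comp_lfun1l.
by rewrite addrC -scaleN1r optrace_linear trS mulN1r addNr.
Qed.

Lemma commutant_subalgebra (S : set 'End(K)) : subalgebra (commutant S).
Proof.
split=> [Y _|a X1 X2 SX1 SX2 Y SY|X1 X2 SX1 SX2 Y SY].
- by rewrite comp_lfun0l comp_lfun0r.
- by rewrite comp_lfunDl comp_lfunDr -comp_lfunZl -comp_lfunZr SX1 // SX2.
- by rewrite comp_lfunA SX1 // -comp_lfunA SX2 // comp_lfunA.
Qed.

(** A map of the form given by [determines] commutes with taking adjoints. *)
Lemma fixed_points_star n (A : 'I_n -> 'End(K)) Phi :
  determines dot A Phi -> star_closed dot (fixed_points Phi).
Proof.
move=> APhi X; rewrite /fixed_points /= => fixX.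
rewrite -[in RHS]fixX !APhi adjoint_sum; apply: eq_bigr => i _.
by rewrite !adjoint_comp adjointK comp_lfunA.
Qed.

End KrausOperators.

Theorem theorem2p1 (R : realType) (K : vectType R[i])
    (dot : {dot K for conjC}) (Phi : {linear 'End(K) -> 'End(K)})
    (n : nat) (A : 'I_n -> 'End(K)) :
  quantum_channel dot Phi -> unital Phi -> determines dot A Phi ->
  [/\ star_algebra dot (generated_algebra A),
      forall (m : nat) (B : 'I_m -> 'End(K)), determines dot B Phi ->
        generated_algebra B = generated_algebra A,
      fixed_points Phi = commutant (generated_algebra A),
      commutant (generated_algebra A) =
        [set X : 'End(K) | forall i : 'I_n, (A i \o X)%VF = (X \o A i)%VF] &
      star_algebra dot (fixed_points Phi) /\ fixed_points Phi \1%VF].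
Proof.
move=> [_ tPhi] uPhi APhi.
have sumAA := unital_kraus uPhi APhi.
have sumA'A := trace_preserving_kraus tPhi APhi.
have fixE := fixed_points_commutant sumAA sumA'A APhi.
split=> //.
- exact: generated_algebra_star sumAA sumA'A.
- move=> m B BPhi; apply/seteqP.
  by split; [exact: kraus_generated_algebra_sub APhi BPhi
           | exact: kraus_generated_algebra_sub BPhi APhi].
- exact: commutant_generated_algebra.
split=> //; split; last exact: fixed_points_star APhi.
(* Closure under products is not visible on the equation Phi X = X; it comes from the commutant. *)
by rewrite fixE; exact: commutant_subalgebra.
Qed.
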